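(* Let $\mathfrak g_1,\mathfrak g_2$ be two $n$-dyons on the same $n$-dimensional vector space $V$, let $C_i$ be the center of $\mathfrak g_i$ and $\Delta_i=[\mathfrak g_i,\mathfrak g_i]$ its derived algebra ($i=1,2$), and put $C_{12}=C_1\cap C_2$. If $\dim C_{12}=n-4$, then $\mathfrak g_1$ and $\mathfrak g_2$ are compatible if and only if $\Delta_1\subset C_2$ and $\Delta_2\subset C_1$.
   Context: The ground field $\mathbf k$ has characteristic zero. An $n$-dyon is a Lie algebra structure on an $n$-dimensional vector space isomorphic to the direct sum of the non-abelian $2$-dimensional Lie algebra and the $(n-2)$-dimensional abelian Lie algebra; thus $\dim C_i=n-2$, $\dim\Delta_i=1$, $C_i\cap\Delta_i=\{0\}$. Two Lie algebra structures on $V$ are compatible if the sum of their brackets is a Lie bracket. *)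

(* Defs.v *)
From HB Require Import structures.
From mathcomp Require Import all_boot all_order all_algebra.

Set Implicit Arguments.
Unset Strict Implicit.
Unset Printing Implicit Defensive.

Import GRing.Theory.
Local Open Scope ring_scope.

Definition is_lie_bracket (F : fieldType) (V : vectType F)
    (br : V -> V -> V) : Prop :=
  [/\ forall x, linear (br x),
      forall y, linear (br^~ y),
      forall x, br x x = 0
    & forall x y z, br x (br y z) + br y (br z x) + br z (br x y) = 0].

Record lie_structure (F : fieldType) (V : vectType F) := LieStructure {
  bracket :> V -> V -> V;
  bracketP : is_lie_bracket bracket
}.

Definition is_abelian (F : fieldType) (V : vectType F)
    (g : lie_structure V) : Prop :=
  forall x y, g x y = 0.

Definition lie_isomorphic (F : fieldType) (V W : vectType F)
    (g : lie_structure V) (h : lie_structure W) : Prop :=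
  exists2 f : {linear V -> W},
    bijective f & forall x y, f (g x y) = h (f x) (f y).

Section DirectSum.

Variables (F : fieldType) (V W : vectType F).
Variables (g : lie_structure V) (h : lie_structure W).

Definition direct_sum_bracket (x y : V * W) : V * W :=
  (g x.1 y.1, h x.2 y.2).

Lemma direct_sum_bracketP : is_lie_bracket direct_sum_bracket.
Proof.
have [gl gr g0 gJ] := bracketP g; have [hl hr h0 hJ] := bracketP h.
split=> [x a y z | y a x z | x | x y z]; rewrite /direct_sum_bracket /=.
- by rewrite gl hl.
- by rewrite gr hr.
- by rewrite g0 h0.
- by congr (_, _); rewrite /= ?gJ ?hJ.
Qed.

Definition direct_sum : lie_structure (V * W)%type :=
  LieStructure direct_sum_bracketP.

End DirectSum.

Definition is_dyon (n : nat) (F : fieldType) (V : vectType F)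
    (g : lie_structure V) : Prop :=
  \dim {:V} = n /\
  exists (L A : vectType F) (l : lie_structure L) (a : lie_structure A),
    [/\ \dim {:L} = 2%N /\ ~ is_abelian l,
        (\dim {:A} + 2)%N = n /\ is_abelian a
      & lie_isomorphic g (direct_sum l a)].

Section CenterDerived.

Variables (F : fieldType) (V : vectType F) (g : lie_structure V).

(* The kernel of the adjoint map x |-> [x, _] from V to End(V). *)
Definition center : {vspace V} := lker (linfun (fun x => linfun (g x))).

(* By bilinearity, brackets of basis vectors span all brackets. *)
Definition derived : {vspace V} :=
  <<[seq g x y | x <- vbasis {:V}, y <- vbasis {:V}]>>%VS.

Let adE x y : linfun (g x) y = g x y.
Proof.
have [gl _ _ _] := bracketP g.
pose m := GRing.isLinear.Build _ _ _ _ (g x) (gl x).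
pose f : {linear V -> V} := HB.pack (g x) m.
exact: (lfunE f).
Qed.

Lemma centerP x : x \in center <-> forall y, g x y = 0.
Proof.
have [_ gr _ _] := bracketP g.
have ad_lin : linear (fun x => linfun (g x)).
  by move=> a u v; apply/lfunP=> y; rewrite add_lfunE scale_lfunE !adE gr.
pose m := GRing.isLinear.Build _ _ _ _ (fun x => linfun (g x)) ad_lin.
pose f : {linear V -> 'End(V)} := HB.pack (fun x => linfun (g x)) m.
rewrite memv_ker (lfunE f) /=; split=> [/eqP fx0 y|gx0].
  by rewrite -adE fx0 zero_lfunE.
by apply/eqP/lfunP=> y; rewrite adE zero_lfunE.
Qed.

Lemma derivedP (U : {vspace V}) :
  (derived <= U)%VS <-> forall x y, g x y \in U.
Proof.
split=> [dU x y|gU]; last first.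
  by apply/span_subvP=> _ /allpairsP[[x y] [_ _ ->]].
have [_ gr _ _] := bracketP g; apply: (subvP dU).
pose m z := GRing.isLinear.Build _ _ _ _ (g^~ z) (gr z).
pose f z : {linear V -> V} := HB.pack (g^~ z) (m z).
rewrite (coord_vbasis (memvf x)) -[g _ y]/(f y _) linear_sum.
apply: memv_suml => i _; rewrite linearZ; apply: memvZ => /=.
rewrite -adE (coord_vbasis (memvf y)) linear_sum; apply: memv_suml => j _.
rewrite linearZ; apply/memvZ/memv_span; rewrite /= adE.
by apply: allpairs_f; apply: mem_nth; rewrite size_tuple.
Qed.

End CenterDerived.

Definition compatible (F : fieldType) (V : vectType F)
    (g1 g2 : lie_structure V) : Prop :=
  is_lie_bracket (fun x y => g1 x y + g2 x y).

(* Main.v *)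
Require Import Defs.
From HB Require Import structures.
From mathcomp Require Import all_boot all_order all_algebra.
From mathcomp Require Import zify.

Set Implicit Arguments.
Unset Strict Implicit.
Unset Printing Implicit Defensive.

Import GRing.Theory.
Local Open Scope ring_scope.

(** Expanding the Jacobi identity of [g1 + g2] and cancelling those of [g1]
    and [g2] shows that compatibility is the vanishing of the six mixed terms:
    the cyclic sums of [g1 x (g2 y z)] and of [g2 x (g1 y z)].  If each derived
    algebra is central for the other bracket, every mixed term is zero
    ([compatible_of_derived_center]).

    For the converse, the dimension hypothesis enters through [C1 + C2 = V]:
    the center of an [n]-dyon has dimension at least [n - 2]
    ([dyon_dim_center]), so [dim (C1 + C2) >= 2 (n - 2) - (n - 4) = n].  Hence
    modulo [C2] every vector lies in [C1], and every value of [g2] is some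
    [g2 y z] with [y] and [z] in [C1].  For such [y] and [z], five of the six
    mixed terms have [y] or [z] as an argument of [g1] and vanish; the identity
    that remains is [g1 x (g2 y z) = 0] for every [x].  So [g2 y z] lies in
    [C1] ([derived_center_of_compatible]), and the other inclusion follows by
    exchanging [g1] and [g2]. *)

Section Bracket.

Variables (F : fieldType) (V : vectType F) (g : lie_structure V).

Lemma bracketDr x y z : g x (y + z) = g x y + g x z.
Proof.
by have [gl _ _ _] := bracketP g; have := gl x 1 y z; rewrite !scale1r.
Qed.

Lemma bracketDl x y z : g (x + y) z = g x z + g y z.
Proof.
by have [_ gr _ _] := bracketP g; have := gr z 1 x y; rewrite !scale1r.
Qed.

Lemma bracket0r x : g x 0 = 0.
Proof. by apply: (addrI (g x 0)); rewrite -bracketDr !addr0. Qed.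

Lemma bracketC x y : g x y = - g y x.
Proof.
have [_ _ g0 _] := bracketP g; apply/eqP; rewrite -addr_eq0.
by have := g0 (x + y); rewrite bracketDl !bracketDr !g0 add0r addr0 => ->.
Qed.

Lemma jacobi x y z : g x (g y z) + g y (g z x) + g z (g x y) = 0.
Proof. by have [_ _ _ gJ] := bracketP g. Qed.

Lemma bracket_centerl x y : x \in center g -> g x y = 0.
Proof. by move/centerP. Qed.

Lemma bracket_centerr x y : y \in center g -> g x y = 0.
Proof. by move=> cy; rewrite bracketC bracket_centerl ?oppr0. Qed.

Lemma mem_derived x y : g x y \in derived g.
Proof. by move: x y; apply/derivedP. Qed.

End Bracket.

Section Compatible.

Variables (F : fieldType) (V : vectType F).
Implicit Types g h : lie_structure V.

Lemma compatible_sym g h : compatible g h -> compatible h g.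
Proof.
case=> gl gr g0 gJ; split=> [x a y z | y a x z | x | x y z].
- by have := gl x a y z; rewrite /= ![h _ _ + _]addrC.
- by have := gr y a x z; rewrite /= ![h _ _ + _]addrC.
- by rewrite addrC.
by have := gJ x y z; rewrite ![h _ _ + _]addrC.
Qed.

Lemma compatible_of_derived_center g h :
  (derived g <= center h)%VS -> (derived h <= center g)%VS -> compatible g h.
Proof.
move=> /subvP gh /subvP hg.
have gh0 x y z : h x (g y z) = 0 by apply/bracket_centerr/gh/mem_derived.
have hg0 x y z : g x (h y z) = 0 by apply/bracket_centerr/hg/mem_derived.
have [gl gr g0 _] := bracketP g; have [hl hr h0 _] := bracketP h.
split=> [x a y z | y a x z | x | x y z] /=.
- by rewrite gl hl scalerDr addrACA.
- by rewrite gr hr scalerDr addrACA.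
- by rewrite g0 h0 addr0.
rewrite !bracketDr !gh0 !hg0 !addr0 !add0r.
by rewrite (addrACA (g x _)) (addrACA (g x _ + _)) !jacobi addr0.
Qed.

(** Since brackets of [h] do not change when elements of [center h] are added
    to their arguments, the first hypothesis lets both arguments be taken in
    [center g]; there the mixed Jacobi identity has a single nonzero term. *)
Lemma derived_center_of_compatible g h :
  (center g + center h)%VS = fullv -> compatible g h ->
  (derived h <= center g)%VS.
Proof.
move=> full [_ _ _ ghJ]; apply/derivedP => y z.
have split_center v : exists2 c, c \in center g & exists2 d,
    d \in center h & v = c + d.
  by apply/memv_addP; rewrite full memvf.
have [y1 cy [y2 dy ->]] := split_center y.
have [z1 cz [z2 dz ->]] := split_center z.
rewrite bracketDr [h _ z2]bracket_centerr // addr0.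
rewrite bracketDl [h y2 _]bracket_centerl // addr0.
apply/centerP => x; rewrite bracketC; apply/eqP; rewrite oppr_eq0; apply/eqP.
have := ghJ x y1 z1; rewrite !bracketDr.
rewrite ![g y1 _]bracket_centerl // ![g z1 _]bracket_centerl //.
rewrite [g x y1]bracket_centerr // !bracket0r !add0r -!addrA.
by rewrite [h x _ + _]addrA jacobi addr0.
Qed.

End Compatible.

(** The isomorphism carries the center of the dyon onto a subspace containing
    the abelian summand. *)
Lemma dyon_dim_center (n : nat) (F : fieldType) (V : vectType F)
    (g : lie_structure V) :
  is_dyon n g -> (n <= \dim (center g) + 2)%N.
Proof.
case=> _ [L [A [l [a [_ [<- a0] [f [f' fK f'K] fg]]]]]].
rewrite leq_add2r.
have i_lin : linear (fun u : A => (0, u) : L * A).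
  by move=> c u v; congr (_, _); rewrite /= scaler0 addr0.
pose m := GRing.isLinear.Build _ _ _ _ (fun u : A => (0, u) : L * A) i_lin.
pose i : {linear A -> (L * A)%type} :=
  HB.pack (fun u : A => (0, u) : L * A) m.
have -> : \dim {:A} = \dim (limg (linfun i)).
  apply/esym/limg_dim_eq/eqP; rewrite -subv0 capfv; apply/subvP => u.
  by rewrite memv_ker memv0 lfunE /= => /eqP [->].
rewrite -(limg_ker_dim (linfun f) (center g)).
apply: leq_trans (leq_addl _ _); apply: dimvS.
apply/subvP => _ /memv_imgP [u _ ->].
rewrite lfunE -(f'K (i u)) -(lfunE f); apply: memv_img.
apply/centerP => y; apply: (can_inj fK); rewrite fg f'K linear0.
by rewrite /= /direct_sum_bracket /= a0 bracketC bracket0r oppr0.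
Qed.

Theorem lemma6p8 (F : fieldType) (charF0 : [pchar F] =i pred0)
    (n : nat) (V : vectType F) (g1 g2 : lie_structure V)
    (dyon1 : is_dyon n g1) (dyon2 : is_dyon n g2)
    (dimC12 : (\dim (center g1 :&: center g2) + 4)%N = n) :
  compatible g1 g2 <->
  (derived g1 <= center g2)%VS /\ (derived g2 <= center g1)%VS.
Proof.
split=> [g12 | [d1 d2]]; last exact: compatible_of_derived_center.
have full : (center g1 + center g2)%VS = fullv.
  apply/eqP; rewrite eqEdim subvf /=; have [-> _] := dyon1.
  have := dyon_dim_center dyon1; have := dyon_dim_center dyon2.
  have := dimv_sum_cap (center g1) (center g2); lia.
split; last exact: derived_center_of_compatible g12.
by apply: derived_center_of_compatible (compatible_sym g12); rewrite addvC.
Qed.
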